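(* Let $G$ be a graph, and $Y \subseteq V$. We have $Q_1(G) = Q_1(G*Y)$ when $G*Y$ is defined, and $Q_1(G) = Q_1(G+Y)$. If $\{u,v\}$ is an edge in $G$ with $u \not= v$ where both $u$ and $v$ are non-loop vertices, then \[ Q_1(G) = Q_1(G\setminus u) + Q_1(G\mathbin{\bar{*}} \{u\}\setminus u) + Q_1(G*\{u,v\}\setminus u). \]
   Context: Graphs are undirected without parallel edges, loops allowed, with vertex set $V$; a graph is identified with its symmetric adjacency matrix over $\mathbb{F}_2$ (diagonal entry $1$ iff the vertex has a loop), and $n(\cdot)$ denotes nullity over $\mathbb{F}_2$ (the empty matrix has nullity $0$). $G[X]$ is the induced subgraph (principal submatrix) on $X$ and $G\setminus u = G[V\setminus\{u\}]$. For $X\subseteq V$ with $G[X]$ nonsingular, $G*X$ is the principal pivot transform of the adjacency matrix on $X$ (again a graph), defined only in that case. $G+X$ is loop complementation: toggle the loops at the vertices of $X$. The dual pivot is $G\mathbin{\bar{*}} X = G+X*X+X$, defined when the pivot inside is defined; operations are applied left to right. The polynomial is $Q_1(G) = \sum_{X\subseteq V} \sum_{Z\subseteq X} y^{n((G+Z)[X])}$. *)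

(* Defs.v *)
From HB Require Import structures.
From mathcomp Require Import all_boot all_order all_algebra.

Set Implicit Arguments.
Unset Strict Implicit.
Unset Printing Implicit Defensive.

Import GRing.Theory.
Local Open Scope ring_scope.

(* A graph (loops allowed, no parallel edges) is identified with its symmetric
   adjacency matrix over F_2, indexed by the finite vertex type V itself. *)
Record graph (V : finType) := Graph {
  adj :> V -> V -> 'F_2;
  adj_sym : forall x y, adj x y = adj y x
}.

Definition adjmx (V : finType) (G : graph V) : 'M['F_2]_#|V| :=
  \matrix_(i, j) G (enum_val i) (enum_val j).

Definition nullity (V : finType) (G : graph V) : nat := \rank (kermx (adjmx G)).

Definition nonsingular (V : finType) (G : graph V) : bool := adjmx G \in unitmx.

Section Operations.
Variables (V : finType) (G : graph V).

Definition induced (X : {set V}) : graph {x : V | x \in X} :=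
  @Graph _ (fun x y => G (val x) (val y)) (fun x y => adj_sym G (val x) (val y)).

Definition delete (u : V) : graph {x : V | x \in ~: [set u]} :=
  induced (~: [set u]).

Definition loop_adj (X : {set V}) (x y : V) : 'F_2 :=
  G x y + ((x == y) && (x \in X))%:R.

Lemma loop_adj_sym X x y : loop_adj X x y = loop_adj X y x.
Proof. by rewrite /loop_adj adj_sym eq_sym; case: eqP => // ->. Qed.

Definition loop_compl (X : {set V}) : graph V := Graph (loop_adj_sym X).

(* The entries of the inverse of the principal submatrix on X, extended by 0
   to V x V. *)
Definition inv_adj (X : {set V}) (x y : V) : 'F_2 :=
  if (insub x, insub y) is (Some x', Some y')
  then invmx (adjmx (induced X)) (enum_rank x') (enum_rank y') else 0.

(* Writing the adjacency matrix as [P Q; R S] with P the block of X, this is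
   [P^-1, - P^-1 Q; R P^-1, S - R P^-1 Q].  It is meaningful only when P is
   nonsingular. *)
Definition pivot_adj (X : {set V}) (x y : V) : 'F_2 :=
  match x \in X, y \in X with
  | true, true => inv_adj X x y
  | true, false => - \sum_(z in X) inv_adj X x z * G z y
  | false, true => \sum_(z in X) G x z * inv_adj X z y
  | false, false =>
      G x y - \sum_(z in X) \sum_(w in X) G x z * inv_adj X z w * G w y
  end.

Lemma inv_adj_sym X x y : inv_adj X x y = inv_adj X y x.
Proof.
rewrite /inv_adj; case: insub => [x'|]; case: insub => [y'|] //.
have trA : (adjmx (induced X))^T = adjmx (induced X).
  by apply/matrixP => i j; rewrite !mxE; exact: adj_sym.
by rewrite -[in LHS]trA -trmx_inv mxE.
Qed.

Lemma pivot_adj_sym X x y : pivot_adj X x y = pivot_adj X y x.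
Proof.
have oppF2 (a : 'F_2) : - a = a by apply: oppr_pchar2; exact: pchar_Fp.
rewrite /pivot_adj; case: (x \in X); case: (y \in X).
- exact: inv_adj_sym.
- rewrite oppF2; apply: eq_bigr => z _.
  by rewrite mulrC inv_adj_sym (adj_sym G z).
- rewrite oppF2; apply: eq_bigr => z _.
  by rewrite mulrC inv_adj_sym (adj_sym G x).
- rewrite adj_sym exchange_big /=; congr (_ - _).
  apply: eq_bigr => z _; apply: eq_bigr => w _.
  by rewrite (adj_sym G x) (adj_sym G z) inv_adj_sym mulrC mulrA mulrAC.
Qed.

Definition pivot (X : {set V}) : graph V := Graph (pivot_adj_sym X).

Definition pivot_defined (X : {set V}) : bool := nonsingular (induced X).

End Operations.

Definition dual_pivot (V : finType) (G : graph V) (X : {set V}) : graph V :=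
  loop_compl (pivot (loop_compl G X) X) X.

Definition dual_pivot_defined (V : finType) (G : graph V) (X : {set V}) : bool :=
  pivot_defined (loop_compl G X) X.

Definition Q1 (V : finType) (G : graph V) : {poly int} :=
  \sum_(X : {set V}) \sum_(Z : {set V} | Z \subset X)
    'X^(nullity (induced (loop_compl G Z) X)).

(* Main.v *)
(* Idea: record a pair [Z \subset X] as a vector [c : V -> {None, Some false,
   Some true}] of types.  The kernel of [(G + Z)[X]] is the set of [x : F_2^V]
   such that at each vertex [v] the pair [(x v, (G x) v)] lies on one of the
   three lines of the plane F_2^2, the one selected by [c v].  A pivot on [Y]
   exchanges the two coordinates of these pairs on [Y], and loop complementation
   shears them, so both permute the three lines at the vertices of [Y]; hence
   they permute the summands of [Q1].  Deletion of [u] keeps the summands with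
   [c u = None], and the two pivots in the recursion move each of the other two
   lines at [u] to that one. *)
Require Import Defs.
From HB Require Import structures.
From mathcomp Require Import all_boot all_order all_algebra.
From mathcomp Require Import mxabelem.

Set Implicit Arguments.
Unset Strict Implicit.
Unset Printing Implicit Defensive.

Import GRing.Theory.
Local Open Scope ring_scope.

(** * The three lines of the plane over F_2 *)

Lemma addF2_eq0 (a b : 'F_2) : (a + b == 0) = (a == b).
Proof. by rewrite addr_eq0 oppr_pchar2 ?pchar_Fp. Qed.

(** [None] is the type of a vertex outside X, where the vector must vanish. [Some e] is the type of
    a vertex of X whose loop is toggled iff [e]: the row equation b + e a = 0 reads b = e a in
    characteristic 2. *)
Definition on_line (c : option bool) (a b : 'F_2) : bool :=
  if c is Some e then b == e%:R * a else a == 0.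

Definition swap_line (c : option bool) : option bool :=
  match c with None => Some false | Some false => None | _ => c end.

Definition shear_line (c : option bool) : option bool := omap negb c.

Lemma swap_lineK : involutive swap_line.
Proof. by do 2?case. Qed.

Lemma shear_lineK : involutive shear_line.
Proof. by do 2?case. Qed.

Lemma on_line_swap c a b : on_line (swap_line c) b a = on_line c a b.
Proof. by case: c => [[]|] /=; rewrite ?mul0r ?mul1r // eq_sym. Qed.

Lemma on_line_shear c a b : on_line (shear_line c) a (b + a) = on_line c a b.
Proof.
case: c => [[]|] //=; rewrite ?mul0r ?mul1r ?addF2_eq0 //.
by rewrite -subr_eq0 addrK.
Qed.

(** * Type vectors and their kernels *)

Section TypeVectors.
Variable V : finType.
Implicit Types (G : graph V) (X Z Y : {set V}) (c : {ffun V -> option bool}).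

Definition img G (x : {ffun V -> 'F_2}) (v : V) : 'F_2 := \sum_z G v z * x z.

Definition line_ker G c : {set {ffun V -> 'F_2}} :=
  [set x : {ffun V -> 'F_2} | [forall v, on_line (c v) (x v) (img G x v)]].

Definition act (s : option bool -> option bool) Y c : {ffun V -> option bool} :=
  [ffun v => if v \in Y then s (c v) else c v].

Lemma actK s Y : involutive s -> involutive (act s Y).
Proof.
move=> sK c; apply/ffunP => v; rewrite !ffunE.
by case: (v \in Y); rewrite ?sK.
Qed.

Definition carrier c : {set V} := [set v | c v != None].
Definition looped c : {set V} := [set v | c v == Some true].

Lemma img_loop G Y x v : img (loop_compl G Y) x v = img G x v + (v \in Y)%:R * x v.
Proof.
rewrite /img /loop_compl /= /loop_adj.
under eq_bigr => z _ do rewrite mulrDl.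
rewrite big_split /=; congr (_ + _).
rewrite (bigD1 v) //= eqxx big1 ?addr0 // => z /negPf zv.
by rewrite eq_sym zv mul0r.
Qed.

Lemma card_line_ker_loop G Y c :
  #|line_ker (loop_compl G Y) (act shear_line Y c)| = #|line_ker G c|.
Proof.
apply: eq_card => x; rewrite !inE; apply: eq_forallb => v.
rewrite img_loop ffunE; case: (v \in Y); rewrite ?mul1r ?mul0r ?addr0 //.
exact: on_line_shear.
Qed.

(** Type [Some false] everywhere demands exactly G x = 0, so this is the ordinary kernel. Since
    nullities are compared through cardinalities, bijections between kernels need not be shown
    linear. *)
Lemma card_nullity G : (2 ^ nullity G)%N = #|line_ker G [ffun=> Some false]|.
Proof.
rewrite -[X in (X ^ _)%N](card_Fp (isT : prime 2)) -card_rowg.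
pose f (u : 'rV['F_2]_#|V|) : {ffun V -> 'F_2} := [ffun v => u 0 (enum_rank v)].
have f_inj : injective f.
  move=> u w /ffunP uw; apply/rowP => i.
  by have := uw (enum_val i); rewrite !ffunE enum_valK.
have f_bij : bijective f.
  by apply: inj_card_bij => //; rewrite card_mx card_ffun mul1n.
rewrite -[RHS](on_card_preimset (onW_bij _ f_bij)).
apply: eq_card => u; rewrite !inE.
have imgf v : (u *m adjmx G) 0 (enum_rank v) = img G (f u) v.
  rewrite mxE /img (reindex _ (onW_bij _ (@enum_rank_bij V))) /=.
  by apply: eq_bigr => z _; rewrite !mxE !enum_rankK ffunE adj_sym mulrC.
apply/sub_kermxP/forallP => [u0 v | u0].
  by rewrite ffunE /= mul0r -imgf u0 mxE.
apply/rowP => i; rewrite -[i]enum_valK imgf mxE.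
by have := u0 (enum_val i); rewrite ffunE /= mul0r => /eqP.
Qed.

End TypeVectors.

(** * Induced subgraphs and extension by zero *)

Section Induced.
Variables (V : finType) (G : graph V) (W : {set V}).
Let S : finType := {x : V | x \in W}.

Definition extend (T : Type) (t : T) (f : {ffun S -> T}) : {ffun V -> T} :=
  [ffun v => if insub v is Some v' then f v' else t].

Lemma extend_val T (t : T) f (v : S) : extend t f (val v) = f v.
Proof. by rewrite ffunE valK. Qed.

Lemma extend_out T (t : T) f v : v \notin W -> extend t f v = t.
Proof. by move=> vW; rewrite ffunE insubN. Qed.

Lemma restrictK (T : Type) (t : T) (f : {ffun V -> T}) :
  (forall v, v \notin W -> f v = t) -> extend t [ffun v : S => f (val v)] = f.
Proof.
move=> ft; apply/ffunP => v; case: (boolP (v \in W)) => vW.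
  by rewrite -[v]/(val (Sub v vW : S)) extend_val ffunE.
by rewrite extend_out // ft.
Qed.

Lemma extend_inj (T : Type) (t : T) : injective (extend t).
Proof.
move=> f g /ffunP fg; apply/ffunP => v.
by have := fg (val v); rewrite !extend_val.
Qed.

Lemma img_extend x (v : S) : img G (extend 0 x) (val v) = img (induced G W) x v.
Proof.
rewrite /img (bigID (mem W)) /= [X in _ + X]big1 ?addr0; last first.
  by move=> z zW; rewrite extend_out // mulr0.
by rewrite big_sub /=; under eq_bigr => z _ do rewrite -[sval z]/(val z) extend_val.
Qed.

(** Type [None] off [W] forces a vector to vanish there and asks nothing of its image there, so
    extension by zero is a bijection between the two kernels. *)
Lemma card_line_ker_induced c :
  #|line_ker (induced G W) c| = #|line_ker G (extend None c)|.
Proof.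
rewrite -(card_imset _ (@extend_inj _ 0)); apply: eq_card => x.
apply/imsetP/idP => [[x' + ->] | ].
  rewrite !inE => /forallP kx; apply/forallP => v.
  case: (boolP (v \in W)) => vW; last by rewrite !extend_out.
  by rewrite -[v]/(val (Sub v vW : S)) img_extend !extend_val; exact: kx.
rewrite inE => /forallP kx.
have x0 v : v \notin W -> x v = 0.
  by move=> vW; have := kx v; rewrite extend_out // => /eqP.
exists [ffun v : S => x (val v)]; last by rewrite restrictK.
rewrite inE; apply/forallP => v.
by rewrite -img_extend restrictK // ffunE; have := kx (val v); rewrite extend_val.
Qed.

End Induced.

(** * The pivot as an exchange of coordinates *)

Section Pivot.
Variables (V : finType) (G : graph V) (Y : {set V}).
Hypothesis GY : pivot_defined G Y.

Lemma inv_adj_mul x y : x \in Y -> y \in Y ->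
  \sum_(z in Y) inv_adj G Y x z * G z y = (x == y)%:R.
Proof.
move=> xY yY; have /matrixP := mulVmx GY.
move=> /(_ (enum_rank (Sub x xY)) (enum_rank (Sub y yY))).
rewrite !mxE (inj_eq enum_rank_inj) -val_eqE /= => <-.
rewrite big_sub /= (reindex _ (onW_bij _ (@enum_rank_bij _))) /=.
apply: eq_big => // z; rewrite !mxE !enum_rankK /= => _.
by rewrite /inv_adj insubT -[sval z]/(val z) valK.
Qed.

Definition pivot_vec (x : {ffun V -> 'F_2}) : {ffun V -> 'F_2} :=
  [ffun v => if v \in Y then img G x v else x v].

(** With P the block of [Y], the image on [Y] is P x_Y plus the contribution of the other
    coordinates; remove the latter and apply the inverse of P. *)
Lemma inv_adj_img x v : v \in Y ->
  \sum_(z in Y) inv_adj G Y v z * (img G x z - \sum_(w | w \notin Y) G z w * x w)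
    = x v.
Proof.
move=> vY; transitivity (\sum_(w in Y) (\sum_(z in Y) inv_adj G Y v z * G z w) * x w).
  under [RHS]eq_bigr => w _ do rewrite mulr_suml.
  rewrite exchange_big /=; apply: eq_bigr => z _.
  rewrite /img (bigID (mem Y)) /= addrK mulr_sumr.
  by apply: eq_bigr => w _; rewrite mulrA.
rewrite (bigD1 v) //= inv_adj_mul // eqxx mul1r big1 ?addr0 // => w /andP[wY wv].
by rewrite inv_adj_mul // eq_sym (negPf wv) mul0r.
Qed.

(** Solving the rows of [Y] for the coordinates in [Y] ([inv_adj_img]) and substituting into the
    other rows yields the four blocks of the pivot. *)
Lemma img_pivot x v :
  img (pivot G Y) (pivot_vec x) v = if v \in Y then x v else img G x v.
Proof.
rewrite {1}/img (bigID (mem Y)) /= /pivot_adj.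
case: (boolP (v \in Y)) => vY.
  rewrite -[RHS](inv_adj_img x vY).
  under [RHS]eq_bigr => z _ do rewrite mulrBr.
  rewrite sumrB; congr (_ + _).
    by apply: eq_bigr => z zY; rewrite zY ffunE zY.
  under [in RHS]eq_bigr => z _ do rewrite mulr_sumr.
  rewrite exchange_big -sumrN /=; apply: eq_bigr => z zY.
  rewrite (negPf zY) ffunE (negPf zY) mulNr mulr_suml.
  by congr (- _); apply: eq_bigr => w _; rewrite mulrA.
rewrite [RHS](bigID (mem Y)) /=.
(* Eliminate the coordinates in [Y]. The image part gives the block R P^-1; the subtracted part
   joins G off [Y] to form the Schur complement S - R P^-1 Q. *)
under [X in _ = X + _]eq_bigr => z zY.
  rewrite -(inv_adj_img x zY); under eq_bigr => w _ do rewrite mulrBr.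
  rewrite sumrB mulrBr; over.
rewrite sumrB -addrA; congr (_ + _).
  under [RHS]eq_bigr => z _ do rewrite mulr_sumr.
  rewrite exchange_big /=; apply: eq_bigr => z zY; rewrite zY ffunE zY mulr_suml.
  by apply: eq_bigr => w _; rewrite mulrA.
rewrite addrC -sumrN.
under eq_bigr => z zY do rewrite (negPf zY) ffunE (negPf zY) mulrBl.
rewrite sumrB sumrN; congr (_ - _).
under eq_bigr => z _ do rewrite mulr_suml.
rewrite exchange_big /=; apply: eq_bigr => w wY.
under eq_bigr => z _ do rewrite mulr_suml.
rewrite exchange_big /= mulr_sumr; apply: eq_bigr => z zY.
by rewrite !mulr_sumr; apply: eq_bigr => t _; rewrite !mulrA.
Qed.

Lemma pivot_vec_inj : injective pivot_vec.
Proof.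
move=> x1 x2 e; apply/ffunP => v; case vY: (v \in Y).
  by have := img_pivot x1 v; rewrite e img_pivot vY.
by move/ffunP/(_ v): e; rewrite !ffunE vY.
Qed.

Lemma card_line_ker_pivot c :
  #|line_ker (pivot G Y) (act swap_line Y c)| = #|line_ker G c|.
Proof.
rewrite -(on_card_preimset (onW_bij _ (injF_bij pivot_vec_inj))).
apply: eq_card => x; rewrite !inE; apply: eq_forallb => v.
rewrite img_pivot !ffunE; case: (v \in Y) => //.
exact: on_line_swap.
Qed.

End Pivot.

(** * The polynomial as a sum over type vectors *)

Section GlobalInterlace.
Variable V : finType.
Implicit Types (G H : graph V) (c : {ffun V -> option bool}).

Definition line_nullity G c : nat :=
  nullity (induced (loop_compl G (looped c)) (carrier c)).

(** Toggling the loops at [looped c] shears [Some true] to [Some false], and extension by [None]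
    encodes the restriction to [carrier c]. *)
Lemma expn_line_nullity G c : (2 ^ line_nullity G c)%N = #|line_ker G c|.
Proof.
rewrite card_nullity card_line_ker_induced -(card_line_ker_loop _ (looped c) c).
congr #|line_ker _ _|; apply/ffunP => v; rewrite !ffunE inE.
case: insubP => [v' vX _|]; last by rewrite inE negbK => /eqP ->.
by rewrite ffunE; move: vX; rewrite inE; case: (c v) => [[]|].
Qed.

Lemma Q1_lines G : Q1 G = \sum_c 'X^(line_nullity G c).
Proof.
rewrite /Q1 pair_big_dep /=.
pose h c := (carrier c, looped c).
(* [p.2] is read only inside [p.1], so [h (h' p) = p] requires [p.2 \subset p.1]. *)
pose h' (p : {set V} * {set V}) : {ffun V -> option bool} :=
  [ffun v => if v \in p.1 then Some (v \in p.2) else None].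
rewrite (reindex_onto h h') /=.
  apply: eq_bigl => c; apply/andP; split.
    by apply/subsetP => v; rewrite !inE => /eqP ->.
  by apply/eqP/ffunP => v; rewrite !ffunE !inE; case: (c v) => [[]|].
case=> X Z /= /subsetP ZX; congr pair; apply/setP => v; rewrite !inE ffunE /=.
  by case: (v \in X).
by case: (boolP (v \in X)) => [_ | /(contraNF (ZX v)) ->]; case: (v \in Z).
Qed.

End GlobalInterlace.

Lemma eq_line_nullity (U V : finType) (G : graph U) (H : graph V) c d :
  #|line_ker G c| = #|line_ker H d| -> line_nullity G c = line_nullity H d.
Proof. by move=> GH; apply: (@expnI 2) => //; rewrite !expn_line_nullity. Qed.

Section LinePermutation.
Variables (V : finType) (G H : graph V) (Y : {set V}).
Variable s : option bool -> option bool.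
Hypothesis sK : involutive s.
Hypothesis card_act : forall c, #|line_ker H (act s Y c)| = #|line_ker G c|.

Lemma Q1_act : Q1 H = Q1 G.
Proof.
rewrite !Q1_lines (reindex_inj (inv_inj (actK Y sK))).
by apply: eq_bigr => c _; rewrite (eq_line_nullity (card_act c)).
Qed.

(** Meant for [s a = None], when [Q1_delete] recognises the sum for [H] as a deletion of [u]. *)
Lemma sum_lines_act u a : u \in Y ->
  \sum_(c : {ffun V -> option bool} | c u == s a) 'X^(line_nullity H c)
    = \sum_(c : {ffun V -> option bool} | c u == a) 'X^(line_nullity G c) :> {poly int}.
Proof.
move=> uY; rewrite (reindex_inj (inv_inj (actK Y sK))) /=.
apply: eq_big => c; first by rewrite ffunE uY (inj_eq (inv_inj sK)).
by rewrite (eq_line_nullity (card_act c)).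
Qed.

End LinePermutation.

(** * Deletion, definedness of pivots and the recursion *)

Lemma Q1_delete (V : finType) (G : graph V) u :
  Q1 (delete G u) =
  \sum_(c : {ffun V -> option bool} | c u == None) 'X^(line_nullity G c).
Proof.
have uW : u \notin ~: [set u] by rewrite !inE eqxx.
rewrite Q1_lines.
rewrite (reindex_onto (@extend _ (~: [set u]) _ None)
  (fun c => [ffun v => c (val v)])) /=; last first.
  move=> c /eqP cu; apply: restrictK => v.
  by rewrite !inE negbK => /eqP ->.
apply: eq_big => [c | c _].
  rewrite extend_out // eqxx; apply/esym/eqP/ffunP => v.
  by rewrite ffunE extend_val.
by rewrite (eq_line_nullity (card_line_ker_induced G c)).
Qed.

(** The composite is the third transposition of lines: it fixes [Some false] and exchanges [None]
    with [Some true]. *)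
Lemma card_line_ker_dual_pivot (V : finType) (G : graph V) Y :
  dual_pivot_defined G Y -> forall c,
  #|line_ker (dual_pivot G Y) (act (shear_line \o swap_line \o shear_line) Y c)|
    = #|line_ker G c|.
Proof.
move=> GY c; rewrite -(card_line_ker_loop G Y) -(card_line_ker_pivot GY).
rewrite -(card_line_ker_loop (pivot (loop_compl G Y) Y) Y); congr #|line_ker _ _|.
by apply/ffunP => v; rewrite !ffunE; case: (v \in Y).
Qed.

(** A square matrix with trivial kernel is invertible; vectors on [Y] are treated as vectors on [V]
    supported in [Y], which avoids handling submatrices. *)
Lemma pivot_defined_ker0 (V : finType) (G : graph V) (Y : {set V}) :
  (forall x : {ffun V -> 'F_2}, (forall v, v \notin Y -> x v = 0) ->
     (forall v, v \in Y -> img G x v = 0) -> x = 0) ->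
  pivot_defined G Y.
Proof.
move=> kerG; rewrite /pivot_defined /nonsingular -row_free_unit -kermx_eq0.
rewrite -mxrank_eq0 -/(nullity _) -(inj_eq (@expnI 2 isT)) card_nullity expn0.
rewrite card_line_ker_induced; apply/cards1P; exists 0.
apply/setP => x; rewrite !inE; apply/forallP/eqP => [kx | -> v].
  apply: kerG => v vY; have := kx v; first by rewrite extend_out // => /eqP.
  rewrite -[v]/(val (Sub v vY : {x : V | x \in Y})) extend_val ffunE /=.
  by rewrite mul0r => /eqP.
have -> : img G 0 v = 0 by rewrite /img big1 // => z _; rewrite ffunE mulr0.
have -> : (0 : {ffun V -> 'F_2}) v = 0 by rewrite ffunE.
by case: (fun_of_fin _ v) => [e|] /=; rewrite ?mulr0.
Qed.

Theorem theorem36 (V : finType) (G : graph V) (Y : {set V}) :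
  [/\ pivot_defined G Y -> Q1 G = Q1 (pivot G Y),
      Q1 G = Q1 (loop_compl G Y)
    & forall u v : V, u != v -> G u v = 1 -> G u u = 0 -> G v v = 0 ->
      [/\ dual_pivot_defined G [set u],
          pivot_defined G [set u; v]
        & Q1 G = Q1 (delete G u)
               + Q1 (delete (dual_pivot G [set u]) u)
               + Q1 (delete (pivot G [set u; v]) u)]].
Proof.
split=> [GY | | u v uv Guv Guu Gvv].
- by rewrite (Q1_act swap_lineK (card_line_ker_pivot GY)).
- by rewrite (Q1_act shear_lineK (card_line_ker_loop G Y)).
(* As [u] has no loop, (G + {u})[{u}] is the 1 by 1 matrix (1). *)
have Du : dual_pivot_defined G [set u].
  apply: pivot_defined_ker0 => x x0 /(_ u (set11 u)).
  rewrite img_loop set11 mul1r /img (bigD1 u) //= Guu mul0r add0r.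
  rewrite big1 ?add0r => [xu | z zu]; last by rewrite x0 ?inE ?mulr0.
  apply/ffunP => z; rewrite ffunE; case: (eqVneq z u) => [-> // | zu].
  by rewrite x0 ?inE.
(* G[{u,v}] is [0 1; 1 0], so row [u] returns [x v] and row [v] returns [x u]. *)
have Duv : pivot_defined G [set u; v].
  apply: pivot_defined_ker0 => x x0 imgx.
  have img2 w : img G x w = G w u * x u + G w v * x v.
    rewrite /img (bigD1 u) //= (bigD1 v) 1?eq_sym //= big1 ?addr0 // => z.
    by move=> /andP[zu zv]; rewrite x0 ?mulr0 // !inE negb_or zu.
  have xv : x v = 0.
    by have := imgx u (set21 u v); rewrite img2 Guu Guv mul0r mul1r add0r.
  have xu : x u = 0.
    by have := imgx v (set22 u v); rewrite img2 adj_sym Guv Gvv mul0r mul1r addr0.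
  apply/ffunP => z; rewrite ffunE.
  case: (eqVneq z u) => [-> // | zu]; case: (eqVneq z v) => [-> // | zv].
  by rewrite x0 // !inE negb_or zu.
split=> //; rewrite !Q1_delete.
have dualK : involutive (shear_line \o swap_line \o shear_line) by do 2?case.
(* The condition [c u == None] is matched by computation: the dual pivot sends [Some true] to
   [None], the pivot on the edge sends [Some false] to [None]. The three deletions thus cover the
   three types at [u]. *)
rewrite (sum_lines_act dualK
  (card_line_ker_dual_pivot Du) (Some true) (set11 u)).
rewrite (sum_lines_act swap_lineK (card_line_ker_pivot Duv) (Some false)
  (set21 u v)).
rewrite Q1_lines (bigID (fun c : {ffun V -> option bool} => c u == None)) /= -addrA.
congr (_ + _); rewrite (bigID (fun c : {ffun V -> option bool} => c u == Some true)) /=.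
by congr (_ + _); apply: eq_bigl => c; case: (c u) => [[]|].
Qed.
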